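(* Let $G$ and $H$ be two graphs. Then their Cartesian product satisfies $$\nu(G\times H)\ge\nu(G)+\nu(H).$$
   Context: All graphs $G=(V,E)$ are finite and simple with nonempty vertex set; $x\sim y$ denotes adjacency. $E^{or}(G)$ is the set of ordered pairs $(x,y)$ with $x\sim y$. A magnetic potential is a map $\sigma:E^{or}(G)\to S^1=\{z\in\mathbb{C}:|z|=1\}$ with $\sigma(y,x)=\sigma(x,y)^{-1}$. The magnetic Laplacian on functions $f:V\to\mathbb{C}$ is $\Delta^\sigma f(x)=\sum_{y\sim x}(f(x)-\sigma(x,y)f(y))$, and $\lambda_1^\sigma(G)$ is its smallest eigenvalue. The magneto-spectral height is $\nu(G)=\sup_\sigma\lambda_1^\sigma(G)$, over all magnetic potentials on $G$. The Cartesian product $G\times H$ has as vertex set the product of the vertex sets, with $(x_1,y_1)\sim(x_2,y_2)$ if and only if either $x_1\sim x_2$ and $y_1=y_2$, or $x_1=x_2$ and $y_1\sim y_2$. *)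

(* Defs.v *)
From HB Require Import structures.
From mathcomp Require Import all_boot all_order all_algebra.
From mathcomp Require Import complex.
From mathcomp Require Import classical_sets reals.

Set Implicit Arguments.
Unset Strict Implicit.
Unset Printing Implicit Defensive.

Import Order.TTheory GRing.Theory Num.Theory.

Local Open Scope classical_set_scope.
Local Open Scope ring_scope.
Local Open Scope complex_scope.

Record sgraph := SGraph {
  vertex :> finType;
  adj : rel vertex;
  adj_sym : symmetric adj;
  adj_irrefl : irreflexive adj;
  vertex_gt0 : (0 < #|vertex|)%N }.

Notation "x ~~> y" := (adj x y) (at level 70, no associativity).

Section CartesianProduct.
Variables G H : sgraph.

Definition cart_adj : rel (vertex G * vertex H) := fun p q =>
  (p.1 ~~> q.1) && (p.2 == q.2) || (p.1 == q.1) && (p.2 ~~> q.2).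

Lemma cart_adj_sym : symmetric cart_adj.
Proof.
by move=> p q; rewrite /cart_adj !(adj_sym q.1, adj_sym q.2) !(eq_sym q.1, eq_sym q.2).
Qed.

Lemma cart_adj_irrefl : irreflexive cart_adj.
Proof. by move=> p; rewrite /cart_adj !adj_irrefl andbF. Qed.

Lemma cart_vertex_gt0 : (0 < #|{: vertex G * vertex H}|)%N.
Proof. by rewrite card_prod muln_gt0 !vertex_gt0. Qed.

Definition cart_prod : sgraph :=
  SGraph cart_adj_sym cart_adj_irrefl cart_vertex_gt0.

End CartesianProduct.

Section Magnetic.
Variables (R : realType) (G : sgraph).

(* A potential lives on ordered edges; it is encoded as a total function    *)
(* whose values off the edges are unconstrained and never used.             *)
Definition magnetic_potential (sigma : G -> G -> R[i]) : Prop :=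
  (forall x y, x ~~> y -> `|sigma x y| = 1) /\
  (forall x y, x ~~> y -> sigma y x = (sigma x y)^-1).

Definition magnetic_laplacian (sigma : G -> G -> R[i])
    (f : {ffun G -> R[i]^o}) : {ffun G -> R[i]^o} :=
  [ffun x => \sum_(y | x ~~> y) (f x - sigma x y * f y)].

Lemma magnetic_laplacian_is_linear sigma : linear (magnetic_laplacian sigma).
Proof.
move=> a f g; apply/ffunP=> x; rewrite !ffunE scaler_sumr -big_split /=.
apply: eq_bigr => y _; rewrite !ffunE scalerBr mulrDr opprD addrACA.
by rewrite /GRing.scale /= mulrCA.
Qed.

HB.instance Definition _ sigma :=
  GRing.isLinear.Build R[i] {ffun G -> R[i]^o} {ffun G -> R[i]^o} _
    (magnetic_laplacian sigma) (magnetic_laplacian_is_linear sigma).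

Definition magnetic_eigenvalue (sigma : G -> G -> R[i]) (mu : R[i]) : bool :=
  passmx.leigenvalue (linfun (magnetic_laplacian sigma)) mu.

Lemma magnetic_eigenvalueP sigma mu :
  reflect (exists2 f : {ffun G -> R[i]^o}, f != 0 &
             forall x, \sum_(y | x ~~> y) (f x - sigma x y * f y) = mu * f x)
          (magnetic_eigenvalue sigma mu).
Proof.
rewrite /magnetic_eigenvalue /passmx.leigenvalue /passmx.leigenspace.
apply: (iffP idP) => [/eqP nz|[f f0 fE]].
  set K := lker _ in nz; exists (vpick K); first by rewrite vpick0; apply/eqP.
  move=> x; have := memv_pick K; rewrite /K memv_ker -/K.
  rewrite add_lfunE opp_lfunE scale_lfunE id_lfunE lfunE subr_eq0.
  by move=> /eqP/ffunP/(_ x); rewrite !ffunE.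
apply/eqP => K0; have : f \in (0%VS : {vspace {ffun G -> R[i]^o}}).
  rewrite -K0 memv_ker add_lfunE opp_lfunE scale_lfunE id_lfunE lfunE subr_eq0.
  by apply/eqP/ffunP => x; rewrite !ffunE fE.
by rewrite memv0; apply/negP.
Qed.

(* In the order of R[i], l%:C <= mu means that mu is real and l <= Re mu.   *)
Definition smallest_eigenvalue (sigma : G -> G -> R[i]) (l : R) : Prop :=
  magnetic_eigenvalue sigma l%:C /\
  (forall mu, magnetic_eigenvalue sigma mu -> l%:C <= mu).

(* For a magnetic potential sigma the Laplacian is Hermitian, so lambda_1   *)
(* exists, and it is at most twice the maximal degree; hence this is the    *)
(* supremum of a nonempty bounded set of reals.                             *)
Definition magneto_height : R :=
  sup [set l : R | exists sigma : G -> G -> R[i],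
    magnetic_potential sigma /\ smallest_eigenvalue sigma l].

End Magnetic.

(* Main.v *)
Require Import Defs.
From mathcomp Require Import all_boot all_order all_algebra.
From mathcomp Require Import complex.
From mathcomp Require Import classical_sets reals.
From HB Require Import structures.
From mathcomp Require Import spectral ring.

(** Given potentials s on G and t on H, let the product graph carry the
    potential that equals s on G-edges and t on H-edges.  Its Laplacian is then
    a sum A + B of two commuting operators, the Laplacian of s acting along the
    G-fibres and that of t acting along the H-fibres.  The heart of the matter
    is that the smallest eigenvalue of A + B is the sum of those of s and t
    ([prod_smallest_eigenvalue]).

    It is an eigenvalue, with the tensor product of two eigenfunctions as
    eigenfunction ([prod_eigenvalueD]).  It is the smallest one because every
    eigenvalue mu of A + B is a sum of an eigenvalue of s and one of t
    ([prod_eigenvalue_split]): the eigenspace of mu is stable under A, since A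
    commutes with A + B, so over an algebraically closed field it contains an
    eigenvector f of A ([stable_subspace_eigenvector]); if A f = a f, then
    B f = (mu - a) f, and restricting f to a G-fibre and to an H-fibre through a
    point where it does not vanish gives eigenfunctions of s and t.  No
    variational characterisation of eigenvalues is involved.

    To pass to suprema, the set of smallest eigenvalues must be nonempty for G
    and H and bounded above for the product.  The trivial potential has smallest
    eigenvalue 0 ([trivial_potential_smallest_eigenvalue]), and every real
    eigenvalue is at most twice the number of vertices
    ([magnetic_eigenvalue_le]). *)

Set Implicit Arguments.
Unset Strict Implicit.
Unset Printing Implicit Defensive.

Import Order.TTheory GRing.Theory Num.Theory.

Local Open Scope ring_scope.

(** * Eigenvectors in a stable subspace *)

(** The restriction of A to U has a matrix of positive size in a basis of U,
    and such a matrix has an eigenvalue over an algebraically closed field. *)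
Lemma stable_subspace_eigenvector (C : numClosedFieldType) (V : vectType C)
    (A : 'End(V)) (U : {vspace V}) :
    (A @: U <= U)%VS -> U != 0%VS ->
  exists a v, [/\ v \in U, v != 0 & A v = a *: v].
Proof.
move=> AU U0; have dimU : (0 < \dim U)%N by rewrite lt0n dimv_eq0.
pose b := vbasis U.
pose M := \matrix_(i < \dim U, j < \dim U) coord b j (A b`_i).
have [a /eigenvalueP[r rM r0]] := eigenvalue_closed M dimU.
pose v := \sum_(i < \dim U) r 0 i *: b`_i.
have bU i : (i < \dim U)%N -> b`_i \in U.
  by move=> ltid; apply/vbasis_mem/mem_nth; rewrite size_tuple.
exists a, v; split.
- by apply: rpred_sum => i _; apply/rpredZ/bU.
- apply: contra_neq r0 => v0; apply/rowP => i; rewrite mxE.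
  by have /freeP := basis_free (vbasisP U); apply.
rewrite linear_sum scaler_sumr.
under eq_bigr => i _.
  have Abi : A b`_i \in U by apply: (subvP AU); rewrite memv_img ?bU.
  rewrite linearZ /= (coord_vbasis Abi) scaler_sumr; over.
rewrite exchange_big; apply: eq_bigr => j _ /=.
have /rowP/(_ j) := rM; rewrite !mxE scalerA => <-.
rewrite scaler_suml; apply: eq_bigr => i _; by rewrite !mxE scalerA.
Qed.

Lemma ffun_neq0_exists (T : finType) (V : nmodType) (f : {ffun T -> V}) :
  f != 0 -> exists x, f x != 0.
Proof.
move=> f0; apply/existsP; apply: contraR f0; rewrite negb_exists => /forallP f0.
by apply/eqP/ffunP => x; rewrite ffunE; apply/eqP; rewrite -[_ == _]negbK f0.
Qed.

(** * Bounds on the magnetic spectrum *)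

Section Spectrum.
Variables (R : realType) (G : sgraph).
Implicit Types (sigma : G -> G -> R[i]) (f : {ffun G -> R[i]^o}).

Lemma sum_normX_gt0 f n : f != 0 -> 0 < \sum_x `|f x| ^+ n.
Proof.
move=> /ffun_neq0_exists[x fx]; rewrite (bigD1 x) //= ltr_pwDl //.
  by rewrite exprn_gt0 // normr_gt0.
by apply: sumr_ge0 => y _; rewrite exprn_ge0.
Qed.

(** Summing |l f(x)| <= sum_(y ~ x) (|f(x)| + |f(y)|) over all x counts each
    |f(x)| at most 2 #|G| times; comparing the sums of norms is an l1 estimate. *)
Lemma magnetic_eigenvalue_le sigma (l : R) :
  magnetic_potential sigma -> magnetic_eigenvalue sigma l%:C%C ->
  l <= (#|G| + #|G|)%:R.
Proof.
move=> [s1 _] /magnetic_eigenvalueP[f f0 fE].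
have S0 : 0 < \sum_x `|f x|.
  by have := sum_normX_gt0 1 f0; under eq_bigr do rewrite expr1.
rewrite -lecR rmorph_nat -(ler_pM2r S0).
apply: (@le_trans _ _ (`|l%:C%C| * \sum_x `|f x|)).
  by rewrite ler_wpM2r ?(ltW S0) // real_ler_norm ?complex_real.
rewrite mulr_sumr; under eq_bigr do rewrite -normrM -fE.
apply: (@le_trans _ _ (\sum_(x : G) \sum_(y : G) (`|f x| + `|f y|))); last first.
  under eq_bigr do rewrite big_split sumr_const /=.
  by rewrite big_split /= sumr_const sumrMnl natrD mulrDl !mulr_natl.
apply: ler_sum => x _; apply: le_trans (ler_norm_sum _ _ _) _.
rewrite [leRHS](bigID (adj x)) /= ler_wpDr ?sumr_ge0 // => [y _|].
  by rewrite addr_ge0.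
by apply: ler_sum => y xy; rewrite (le_trans (ler_normB _ _)) // normrM s1 // mul1r.
Qed.

Lemma trivial_potential : magnetic_potential (fun _ _ : G => 1 : R[i]).
Proof. by split=> x y _; rewrite ?normr1 ?invr1. Qed.

(** Constants are eigenfunctions for 0, and the quadratic form of the
    Laplacian is half the sum of |f(x) - f(y)|^2 over oriented edges, so it is
    nonnegative. *)
Lemma trivial_potential_smallest_eigenvalue :
  smallest_eigenvalue (fun _ _ : G => 1 : R[i]) 0.
Proof.
split.
  apply/magnetic_eigenvalueP; exists [ffun => 1] => [|x].
    have /card_gt0P[x _] := vertex_gt0 G.
    by apply/eqP => /ffunP/(_ x)/eqP; rewrite !ffunE oner_eq0.
  by rewrite big1 ?mul0r // => y _; rewrite !ffunE mulr1 subrr.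
move=> mu /magnetic_eigenvalueP[f f0 fE].
have S0 := sum_normX_gt0 2 f0.
rewrite -(pmulr_lge0 _ S0) -(pmulr_lge0 _ (ltr0n _ 2)).
(* The two endpoints of an edge contribute E x y and E y x to the quadratic
   form, and E x y + E y x = `|f x - f y| ^+ 2. *)
pose E x y := (f x - f y) * (f x)^*.
suff -> : mu * (\sum_x `|f x| ^+ 2) * 2%:R =
    \sum_x \sum_(y | x ~~> y) `|f x - f y| ^+ 2.
  by apply: sumr_ge0 => x _; apply: sumr_ge0 => y _; rewrite exprn_ge0.
have -> : mu * (\sum_x `|f x| ^+ 2) = \sum_x \sum_(y | x ~~> y) E x y.
  rewrite mulr_sumr; apply: eq_bigr => x _.
  rewrite normCK mulrA -fE mulr_suml; apply: eq_bigr => y _.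
  by rewrite mul1r.
rewrite mulr_natr mulr2n.
have {2}-> : \sum_x \sum_(y | x ~~> y) E x y = \sum_x \sum_(y | x ~~> y) E y x.
  rewrite (exchange_big_dep xpredT) //=; apply: eq_bigr => x _.
  by apply: eq_bigl => y; rewrite adj_sym.
rewrite -big_split; apply: eq_bigr => x _; rewrite -big_split.
apply: eq_bigr => y _ /=; rewrite normCK rmorphB /E /=; ring.
Qed.

End Spectrum.

(** * The spectrum of a Cartesian product *)

Section CartesianProduct.
Variables (R : realType) (G H : sgraph).
Variables (s : G -> G -> R[i]) (t : H -> H -> R[i]).
Local Notation GH := (cart_prod G H).
Local Notation F := {ffun GH -> R[i]^o}.

Definition prod_potential (p q : GH) : R[i] :=
  if p.2 == q.2 then s p.1 q.1 else t p.2 q.2.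

Lemma sum_cart_adj (V : nmodType) (p : GH) (E : GH -> V) :
  \sum_(q | p ~~> q) E q =
    \sum_(x | p.1 ~~> x) E (x, p.2) + \sum_(y | p.2 ~~> y) E (p.1, y).
Proof.
rewrite (bigID (fun q : GH => p.2 == q.2)) /=; congr (_ + _).
  rewrite (reindex_onto (fun x => (x, p.2)) fst) /=; last first.
    by move=> [x y] /= /andP[_ /eqP->].
  by apply: eq_bigl => x; rewrite /cart_adj /= !eqxx adj_irrefl !andbF !andbT orbF.
rewrite (reindex_onto (fun y => (p.1, y)) snd) /=; last first.
  by move=> [x y] /=; rewrite /cart_adj /= => /andP[/orP[/andP[_ ->]//|/andP[/eqP-> _]]].
apply: eq_bigl => y; rewrite /cart_adj /= !eqxx adj_irrefl !andbT /=.
by case: eqVneq => [<-|]; rewrite ?adj_irrefl ?andbT.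
Qed.

Lemma prod_potentialP : magnetic_potential s -> magnetic_potential t ->
  magnetic_potential prod_potential.
Proof.
move=> [s1 sV] [t1 tV].
split=> -[x y] [x' y']; rewrite /= /cart_adj /prod_potential /= => adj_pq.
  case: eqVneq adj_pq => [->|_]; rewrite ?adj_irrefl ?andbT ?andbF ?orbF /=.
    exact: s1.
  by move=> /andP[_ /t1].
rewrite (eq_sym y'); case: eqVneq adj_pq => [->|_].
  by rewrite adj_irrefl andbT andbF orbF; apply: sV.
by rewrite andbF => /andP[_ /tV].
Qed.

Definition left_laplacian (f : F) : F :=
  [ffun p => \sum_(x | p.1 ~~> x) (f p - s p.1 x * f (x, p.2))].

Definition right_laplacian (f : F) : F :=
  [ffun p => \sum_(y | p.2 ~~> y) (f p - t p.2 y * f (p.1, y))].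

Lemma left_laplacian_is_linear : linear left_laplacian.
Proof.
move=> a f g; apply/ffunP=> p; rewrite !ffunE scaler_sumr -big_split /=.
by apply: eq_bigr => x _; rewrite !ffunE /GRing.scale /=; ring.
Qed.

HB.instance Definition _ :=
  GRing.isLinear.Build R[i] F F _ left_laplacian left_laplacian_is_linear.

Lemma prod_laplacianE f :
  magnetic_laplacian prod_potential f = left_laplacian f + right_laplacian f.
Proof.
apply/ffunP => p; rewrite !ffunE sum_cart_adj; congr (_ + _); apply: eq_bigr => z adj_z.
  by rewrite /prod_potential eqxx.
rewrite /prod_potential /=; case: eqVneq adj_z => // <-.
by rewrite adj_irrefl.
Qed.

(** Both sides are the same double sum over x ~ p.1 and y ~ p.2, since the
    weights s p.1 x and t p.2 y depend on different coordinates. *)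
Lemma left_right_laplacianC f :
  left_laplacian (right_laplacian f) = right_laplacian (left_laplacian f).
Proof.
apply/ffunP => p; rewrite !ffunE.
under eq_bigr do rewrite !ffunE /= mulr_sumr -sumrB.
under [RHS]eq_bigr do rewrite !ffunE /= mulr_sumr -sumrB.
rewrite exchange_big; apply: eq_bigr => y _; apply: eq_bigr => x _; ring.
Qed.

(** The eigenspace of mu is stable under the left Laplacian A, which commutes
    with A + B; an eigenvector of A in it is automatically one of B. *)
Lemma prod_eigenvalue_split mu : magnetic_eigenvalue prod_potential mu ->
  exists a b, [/\ magnetic_eigenvalue s a, magnetic_eigenvalue t b & mu = a + b].
Proof.
move=> mu_eig; pose L := linfun (magnetic_laplacian prod_potential).
have memU f : (f \in passmx.leigenspace L mu) =
    (magnetic_laplacian prod_potential f == mu *: f).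
  by rewrite memv_ker add_lfunE opp_lfunE scale_lfunE id_lfunE lfunE subr_eq0.
have stabU : (linfun left_laplacian @: passmx.leigenspace L mu
    <= passmx.leigenspace L mu)%VS.
  apply/subvP => _ /memv_imgP[f fU ->]; move: fU; rewrite !memU !lfunE /=.
  move=> /eqP; rewrite !prod_laplacianE => fE.
  by rewrite -left_right_laplacianC -linearD /= fE linearZ.
have [a [f []]] := stable_subspace_eigenvector stabU mu_eig.
rewrite memU lfunE prod_laplacianE /= => /eqP LfE f0 AfE.
have BfE : right_laplacian f = (mu - a) *: f.
  by rewrite scalerBl -LfE AfE addrC addKr.
have [[x y] fxy] := ffun_neq0_exists f0.
(* The fibres through a point where f is nonzero carry eigenfunctions of
   s and t. *)
exists a, (mu - a); split; last by rewrite addrC subrK.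
  apply/magnetic_eigenvalueP; exists [ffun x' => f (x', y)].
    by apply: contra_neq fxy => /ffunP/(_ x); rewrite !ffunE.
  move=> x'; have /ffunP/(_ (x', y)) := AfE; rewrite !ffunE => fE.
  by apply: etrans fE; apply: eq_bigr => x'' _; rewrite !ffunE.
apply/magnetic_eigenvalueP; exists [ffun y' => f (x, y')].
  by apply: contra_neq fxy => /ffunP/(_ y); rewrite !ffunE.
move=> y'; have /ffunP/(_ (x, y')) := BfE; rewrite !ffunE => fE.
by apply: etrans fE; apply: eq_bigr => y'' _; rewrite !ffunE.
Qed.

Lemma prod_eigenvalueD a b :
  magnetic_eigenvalue s a -> magnetic_eigenvalue t b ->
  magnetic_eigenvalue prod_potential (a + b).
Proof.
move=> /magnetic_eigenvalueP[f f0 fE] /magnetic_eigenvalueP[g g0 gE].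
apply/magnetic_eigenvalueP; exists [ffun p : GH => (f p.1 : R[i]) * g p.2].
  have [[x fx] [y gy]] := (ffun_neq0_exists f0, ffun_neq0_exists g0).
  apply/eqP => /ffunP/(_ (x, y))/eqP; rewrite !ffunE /=.
  by rewrite mulf_eq0 (negPf fx) (negPf gy).
set fg := finfun _ => p.
have := prod_laplacianE fg => /ffunP/(_ p); rewrite !ffunE => ->.
rewrite mulrDl; congr (_ + _); rewrite mulrA.
  rewrite -fE mulr_suml; apply: eq_bigr => x _; rewrite !ffunE /=; ring.
rewrite mulrAC -gE mulr_suml; apply: eq_bigr => x _; rewrite !ffunE /=; ring.
Qed.

Lemma prod_smallest_eigenvalue (l m : R) :
  smallest_eigenvalue s l -> smallest_eigenvalue t m ->
  smallest_eigenvalue prod_potential (l + m).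
Proof.
move=> [l_eig l_min] [m_eig m_min]; rewrite /smallest_eigenvalue rmorphD /=.
split; first exact: prod_eigenvalueD.
by move=> _ /prod_eigenvalue_split[a [b [/l_min la /m_min mb ->]]]; apply: lerD.
Qed.

End CartesianProduct.

(** * Superadditivity of the magneto-spectral height *)

Theorem lemma4p10 (R : realType) (G H : sgraph) :
  magneto_height R (cart_prod G H) >= magneto_height R G + magneto_height R H.
Proof.
have nonempty (K : sgraph) : exists l : R, exists sigma : K -> K -> R[i],
    magnetic_potential sigma /\ smallest_eigenvalue sigma l.
  exists 0, (fun _ _ => 1); split; first exact: trivial_potential.
  exact: trivial_potential_smallest_eigenvalue.
rewrite -lerBrDr; apply: ge_sup; first exact: nonempty.
move=> l [s [s_pot s_l]]; rewrite lerBrDl -lerBrDr.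
apply: ge_sup; first exact: nonempty.
move=> m [t [t_pot t_m]]; rewrite lerBrDl.
apply: ub_le_sup.
  exists (#|cart_prod G H| + #|cart_prod G H|)%:R => k [sigma [sigma_pot [k_eig _]]].
  exact: magnetic_eigenvalue_le k_eig.
exists (prod_potential s t); split; first exact: prod_potentialP.
exact: prod_smallest_eigenvalue.
Qed.
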